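(* Let $p$ and $q=p+2$ be odd primes and $y_{pq}$ the Golomb sequence. Then its $p\times q$ finite Zak transform $X_q\{y_{pq}\}(j,k)=\sum_{r=0}^{q-1}y_{pq}(k+rp)e^{2\pi i rj/q}$ ($0\le j<q$, $0\le k<p$) is $$X_q\{y_{pq}\}(j,k)=\begin{cases}1-\alpha+\alpha q,& j=k=0,\\ \frac{(1-\alpha)(q+1)}{2}+\alpha q,& j=0,\ k\ne0,\\ 1-\alpha,& k=0,\ j\neq0,\\ \frac{1-\alpha}{2}\,A\,e^{-2\pi i\frac{p^{-1}kj}{q}},& j\ne0,\ k\ne0,\end{cases}$$ where $A=1+c_q\left(\frac{p}{q}\right)\left(\frac{k}{p}\right)\left(\frac{j}{q}\right)$, $p^{-1}$ is the inverse of $p$ modulo $q$, and $c_q=\sqrt q$ if $q\equiv1\pmod 4$, $c_q=i\sqrt q$ if $q\equiv3\pmod4$.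
   Context: Legendre/Jacobi symbols $\left(\frac{a}{M}\right)$ are zero when $\gcd(a,M)>1$. The modified Jacobi sequence $x_{pq}$ on $\mathbb{Z}/pq$ (extended periodically) is: $x_{pq}(0)=1$; $x_{pq}(n)=0$ if $p\mid n$, $q\nmid n$; $x_{pq}(n)=1$ if $q\mid n$, $p\nmid n$; for $\gcd(n,pq)=1$, $x_{pq}(n)=1$ if $\left(\frac{n}{pq}\right)=1$ and $0$ otherwise. The Golomb sequence is $y_{pq}=(1-\alpha)x_{pq}+\alpha 1_{pq}$ (value $1$ where $x_{pq}=1$ and $\alpha$ where $x_{pq}=0$), with $\alpha=e^{i\Phi}$, $\Phi=\arccos\!\left(-\frac{pq-1}{pq+1}\right)$. *)

(* Defs.v *)
From HB Require Import structures.
From mathcomp Require Import all_boot all_order all_algebra.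
From mathcomp Require Import all_classical all_reals all_analysis.
From mathcomp Require Import complex.
Set Implicit Arguments. Unset Strict Implicit. Unset Printing Implicit Defensive.
Import Order.TTheory GRing.Theory Num.Theory.
Local Open Scope ring_scope.

Definition expi {R : realType} (t : R) : R[i] := (cos t +i* sin t)%C.

Definition legendre (a p : nat) : int :=
  if (p %| a)%N then 0
  else if [exists x : 'I_p, (x ^ 2 == a %[mod p])%N] then 1 else -1.

Definition jacobi2 (a p q : nat) : int := legendre a p * legendre a q.

(* modified Jacobi sequence x_{pq}, extended periodically (n : nat) *)
Definition xpq (p q n : nat) : nat :=
  if (n %% (p * q) == 0)%N then 1
  else if (p %| n)%N && ~~ (q %| n)%N then 0
  else if (q %| n)%N && ~~ (p %| n)%N then 1
  else if jacobi2 n p q == 1 then 1 else 0.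

Definition golomb_alpha {R : realType} (p q : nat) : R[i] :=
  expi (acos (- (((p * q)%:R - 1) / ((p * q)%:R + 1)) : R)).

Definition ypq {R : realType} (p q n : nat) : R[i] :=
  (1 - golomb_alpha p q) * (xpq p q n)%:R + golomb_alpha p q.

Definition zak {R : realType} (y : nat -> R[i]) (p q j k : nat) : R[i] :=
  \sum_(r < q) y (k + r * p)%N * expi (2 * pi * (r * j)%:R / q%:R).

Definition cq {R : realType} (q : nat) : R[i] :=
  if (q %% 4 == 1)%N then ((Num.sqrt (q%:R : R)) +i* 0)%C
  else (0 +i* Num.sqrt (q%:R : R))%C.

(* Main.v *)
Require Import Defs.
From HB Require Import structures.
From mathcomp Require Import all_boot all_order all_algebra.
From mathcomp Require Import all_classical all_reals all_analysis.
From mathcomp Require Import complex.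
From mathcomp Require Import ring zify.
Import Order.TTheory GRing.Theory Num.Theory.
Local Open Scope ring_scope.

(** On residues k + r p prime to p one has 2 x_pq = 1 + (k/p)(./q) + [q | .], so
    every Zak coefficient reduces to character sums over F_q, and in the end to
    the quadratic Gauss sum G = sum_k z^(k^2) with z = e^(2 i pi / q), q = 2n+1.
    Its exact value, sign included, follows Gauss: the alternating sum of the
    q-binomials [2n, k]_w is prod_(j < n) (1 - w^(2j+1)), and for w = z^-2 the
    summands become z^(k(k+1)). Completing the square gives
    G = prod_(j < n) (z^(2j+1) - z^-(2j+1)) = i^n prod_(j < n) 2 sin(2 pi (2j+1)/q),
    where exactly floor(n/2) of the sines are negative, and G(z) G(z^-1) = q. *)

(** * Quadratic character of a finite field in which 2 is nonzero *)

Section QuadraticCharacter.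
Variable F : finFieldType.

Definition quad_char (a : F) : int :=
  if a == 0 then 0 else if [exists x, x ^+ 2 == a] then 1 else -1.

Lemma quad_char0 : quad_char 0 = 0.
Proof. by rewrite /quad_char eqxx. Qed.

Lemma quad_charX2 (a : F) : a != 0 -> quad_char (a ^+ 2) = 1.
Proof.
move=> a0; rewrite /quad_char expf_eq0 /= (negPf a0).
by rewrite ifT //; apply/existsP; exists a.
Qed.

Lemma quad_charP (a : F) : a != 0 ->
  (exists2 b, a = b ^+ 2 & quad_char a = 1) \/ quad_char a = -1.
Proof.
move=> a0; rewrite /quad_char (negPf a0); case: ifP; last by right.
by move=> /existsP[b /eqP <-]; left; exists b.
Qed.

Lemma quad_char_le1 (a : F) : quad_char a <= 1.
Proof. by rewrite /quad_char; case: ifP => // _; case: ifP. Qed.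

Hypothesis nz2 : (2 : F) != 0.

Lemma sum_sqrt (a : F) : \sum_(x | x ^+ 2 == a) 1 = 1 + quad_char a.
Proof.
have [->|a0] := eqVneq a 0.
  rewrite /quad_char eqxx addr0 (big_pred1 0) // => x.
  by rewrite expf_eq0.
rewrite /quad_char (negPf a0); case: ifP => [/existsP[b /eqP ba]|].
  have b0 : b != 0 by apply: contraNneq a0 => b0; rewrite -ba b0 expr0n.
  have bNb : - b != b.
    by rewrite eq_sym -subr_eq0 opprK -mulr2n -mulr_natl mulf_neq0.
  rewrite (bigD1 b) ?ba //= (bigD1 (- b)) ?sqrrN ?ba ?eqxx //= big1 // => x.
  by rewrite -ba eqf_sqr => /andP[/andP[/orP[]/eqP->]]; rewrite eqxx.
move=> /negbT; rewrite negb_exists => /forallP h.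
by rewrite big_pred0 ?subrr // => x; exact: negbTE.
Qed.

(** Adding 1 to each value counts square roots ([sum_sqrt]), and every x is a square root of exactly
    one element. *)
Lemma sum_quad_char : \sum_a quad_char a = 0.
Proof.
suff : \sum_(a : F) (1 + quad_char a) = \sum_(a : F) 1.
  by rewrite big_split /= -[RHS]addr0 => /addrI.
under eq_bigr do rewrite -sum_sqrt.
by rewrite [RHS](partition_big (fun x : F => x ^+ 2) xpredT).
Qed.

(* For a non-square [a], [quad_char (a t) + quad_char t <= 0] for every [t],
   while these numbers sum to 0: hence they all vanish. *)
Lemma quad_charM (a b : F) : quad_char (a * b) = quad_char a * quad_char b.
Proof.
have [->|a0] := eqVneq a 0; first by rewrite mul0r /quad_char eqxx mul0r.
have sqM c t : c != 0 -> quad_char (c ^+ 2 * t) = quad_char t.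
  move=> c0; rewrite /quad_char mulf_eq0 expf_eq0 /= (negPf c0) /=.
  case: ifP => // _; congr (if _ then _ else _).
  apply/existsP/existsP => -[x /eqP hx].
    by exists (x / c); rewrite expr_div_n hx mulrAC mulfV ?mul1r ?expf_neq0.
  by exists (c * x); rewrite exprMn hx.
have [[c ac ->]|a1] := quad_charP _ a0.
  rewrite ac mul1r sqM //; apply: contraNneq a0 => c0.
  by rewrite ac c0 expr0n.
have le0 t : quad_char (a * t) + quad_char t <= 0.
  have [->|t0] := eqVneq t 0; first by rewrite mulr0 /quad_char eqxx.
  have [[c tc t1]|->] := quad_charP _ t0; last by rewrite subr_le0 quad_char_le1.
  rewrite {1}tc mulrC sqM ?a1 ?t1 //; apply: contraNneq t0 => c0.
  by rewrite tc c0 expr0n.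
have sum0 : \sum_t (- (quad_char (a * t) + quad_char t)) = 0.
  rewrite sumrN big_split /= sum_quad_char addr0.
  rewrite (reindex_inj (mulfI (invr_neq0 a0))) /=.
  under eq_bigr do rewrite mulVKf //.
  by rewrite sum_quad_char oppr0.
have /psumr_eq0P h : forall t, xpredT t -> 0 <= - (quad_char (a * t) + quad_char t).
  by move=> t _; rewrite oppr_ge0.
have /eqP := h sum0 b isT.
by rewrite oppr_eq0 addr_eq0 a1 mulN1r => /eqP.
Qed.

Lemma quad_charV (a : F) : quad_char a^-1 = quad_char a.
Proof.
have [->|a0] := eqVneq a 0; first by rewrite invr0.
have -> : a^-1 = a * a^-1 ^+ 2 by rewrite expr2 mulrA mulfV // mul1r.
by rewrite quad_charM // quad_charX2 ?invr_neq0 // mulr1.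
Qed.

(** Grouping x by its square gives fibres of size 1 + [quad_char t]. This later turns the sum of
    z^(k^2) into a sum of the quadratic character against an additive one. *)
Lemma sum_quad_char_sq (V : comNzRingType) (f : F -> V) :
  \sum_x f (x ^+ 2) = \sum_t (1 + (quad_char t)%:~R) * f t.
Proof.
rewrite (partition_big (fun x : F => x ^+ 2) xpredT) //=.
apply: eq_bigr => t _; rewrite -[1]/(1%:~R) -intrD -sum_sqrt.
rewrite rmorph_sum /= mulr_suml; apply: eq_bigr => x /eqP ->.
by rewrite mul1r.
Qed.

End QuadraticCharacter.

(** * Gaussian binomials and their alternating sums *)

Section GaussPolynomial.
Variables (A : comNzRingType) (x : A).

(** The Gaussian binomial [m, k]_x. The Pascal rule avoids quotients by 1 - x^i, so x may be a root
    of unity. Truncation of m' - k' is harmless, since [qbin m' k'] vanishes when k' > m'. *)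
Fixpoint qbin (m k : nat) : A :=
  match m, k with
  | _, 0 => 1
  | 0, _.+1 => 0
  | m'.+1, k'.+1 => qbin m' k'.+1 + x ^+ (m' - k') * qbin m' k'
  end.

Arguments qbin : simpl never.

Lemma qbin0 m : qbin m 0 = 1. Proof. by case: m. Qed.

Lemma qbinS m k :
  qbin m.+1 k.+1 = qbin m k.+1 + x ^+ (m - k) * qbin m k.
Proof. by []. Qed.

Lemma qbin_small m k : (m < k)%N -> qbin m k = 0.
Proof.
elim: m k => [|m IH] [|k] //; rewrite ltnS => h.
by rewrite qbinS !IH ?mulr0 ?addr0 // ltnS ltnW.
Qed.

(** Stated with row m of [qbin_right] as a hypothesis, so that the induction proving [qbin_right]
    can call it. *)
Lemma qbin_up_of m k :
  (forall k, (1 - x ^+ k.+1) * qbin m k.+1 = (1 - x ^+ (m - k)) * qbin m k) ->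
  (1 - x ^+ (m.+1 - k)) * qbin m.+1 k = (1 - x ^+ m.+1) * qbin m k.
Proof.
case: k => [|k] IH; first by rewrite !qbin0 subn0.
rewrite qbinS subSS mulrDr mulrCA -IH.
have [km|mk] := leqP k m; last by rewrite qbin_small ?mulr0 ?addr0 // ltnW.
have -> : x ^+ m.+1 = x ^+ (m - k) * x ^+ k.+1 by rewrite -exprD addnS subnK.
by ring.
Qed.

Lemma qbin_right m k :
  (1 - x ^+ k.+1) * qbin m k.+1 = (1 - x ^+ (m - k)) * qbin m k.
Proof.
elim: m k => [|m IH] k; first by rewrite mulr0 expr0 subrr mul0r.
rewrite qbin_up_of // qbinS mulrDr IH.
have [km|mk] := leqP k m; last by rewrite qbin_small ?mulr0 ?addr0.
have -> : x ^+ m.+1 = x ^+ (m - k) * x ^+ k.+1 by rewrite -exprD addnS subnK.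
by ring.
Qed.

Lemma qbin_up m k :
  (1 - x ^+ (m.+1 - k)) * qbin m.+1 k = (1 - x ^+ m.+1) * qbin m k.
Proof. exact/qbin_up_of/qbin_right. Qed.

(** By [qbin_up], (1 - x^(m+1)) [m, k] = [m+1, k] - x^(m+1-k) [m+1, k]. With alternating signs these
    two terms are the ones that the Pascal rule produces from row m+2. *)
Lemma alt_sum_qbinSS m :
  \sum_(k < m.+3) (-1) ^+ k * qbin m.+2 k =
  (1 - x ^+ m.+1) * \sum_(k < m.+1) (-1) ^+ k * qbin m k.
Proof.
have -> : \sum_(k < m.+1) (-1) ^+ k * qbin m k
        = \sum_(k < m.+2) (-1) ^+ k * qbin m k.
  by rewrite [RHS]big_ord_recr /= (@qbin_small m m.+1) // mulr0 addr0.
rewrite mulr_sumr; under [RHS]eq_bigr do rewrite mulrCA -qbin_up mulrBl mul1r.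
rewrite [LHS]big_ord_recl /=.
under eq_bigr do rewrite /bump leq0n add1n qbinS mulrDr.
rewrite big_split /= addrA.
under [RHS]eq_bigr do rewrite mulrBr.
rewrite sumrB; congr (_ + _); last first.
  by rewrite -sumrN; apply: eq_bigr => k _; rewrite exprS mulN1r mulNr.
rewrite [in LHS]big_ord_recr /= (@qbin_small m.+1 m.+2) // mulr0 addr0.
by rewrite [RHS]big_ord_recl /= !qbin0.
Qed.

Lemma alt_sum_qbin n :
  \sum_(k < n.*2.+1) (-1) ^+ k * qbin n.*2 k =
  \prod_(j < n) (1 - x ^+ j.*2.+1).
Proof.
elim: n => [|n IH]; first by rewrite big_ord0 big_ord1 mulr1.
by rewrite doubleS alt_sum_qbinSS IH big_ord_recr /= mulrC.
Qed.

End GaussPolynomial.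

(** * The quadratic Gauss sum of a primitive root of odd order *)

Section GaussSum.
Variables (C : fieldType) (n : nat).
Let q := n.*2.+1.

(** As w^(2n-k) = w^-(k+1), [qbin_right] says that [2n, k+1] = -w^-(k+1) [2n, k]. The exponents 1,
    ..., k add up to 'C(k+1, 2). *)
Lemma qbin_prim_root (w : C) k : q.-primitive_root w -> (k < q)%N ->
  qbin C w n.*2 k * w ^+ 'C(k.+1, 2) = (-1) ^+ k.
Proof.
move=> wq; elim: k => [|k IH] kq; first by rewrite qbin0 mul1r.
have wk : 1 - w ^+ k.+1 != 0.
  rewrite subr_eq0 eq_sym -(prim_order_dvd wq).
  by apply: contraTN kq => /dvdn_leq; rewrite -leqNgt; apply.
apply: (mulfI wk); rewrite mulrA qbin_right binS bin1 exprD.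
have -> : (1 - w ^+ (n.*2 - k)) * qbin C w n.*2 k * (w ^+ 'C(k.+1, 2) * w ^+ k.+1)
  = (w ^+ k.+1 - w ^+ (n.*2 - k) * w ^+ k.+1) * (qbin C w n.*2 k * w ^+ 'C(k.+1, 2)).
  by ring.
rewrite IH; last exact: ltnW.
rewrite -exprD addnS subnK; last by rewrite -ltnS ltnW.
by rewrite (prim_expr_order wq) [(-1) ^+ k.+1]exprS; ring.
Qed.

Variable z : C.
Hypothesis zq : q.-primitive_root z.

Lemma prim_root_neq0 : z != 0. Proof. by rewrite (prim_root_eq0 zq). Qed.

Lemma prim_expr_eqmod i k : (i = k %[mod q])%N -> z ^+ i = z ^+ k.
Proof. by move=> h; rewrite -(prim_expr_mod zq) h (prim_expr_mod zq). Qed.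

Lemma prim_rootV : q.-primitive_root z^-1.
Proof.
suff -> : z^-1 = z ^+ n.*2 by rewrite prim_root_exp_coprime // coprimenS.
apply: (mulfI prim_root_neq0).
by rewrite mulfV ?prim_root_neq0 // -exprS prim_expr_order.
Qed.

Lemma sum_expr_pronic :
  \sum_(k < q) z ^+ (k * k.+1) = \prod_(j < n) (1 - (z ^- 2) ^+ j.*2.+1).
Proof.
have wq : q.-primitive_root (z ^- 2).
  rewrite -exprVn (prim_root_exp_coprime _ prim_rootV).
  by rewrite coprime2n /= odd_double.
rewrite -alt_sum_qbin; apply: eq_bigr => k _.
(* Since 2 'C(k+1, 2) = k(k+1), the factor multiplied in is the inverse of z^(k(k+1)). *)
apply: (mulIf (expf_neq0 'C(k.+1, 2) (invr_neq0 (expf_neq0 2 prim_root_neq0)))).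
rewrite -mulrA qbin_prim_root // -exprMn mulrNN mulr1 expr1n.
rewrite exprVn -exprM -mul_bin_diag bin1 mulnC mulfV //.
by rewrite expf_neq0 // prim_root_neq0.
Qed.

Lemma sum_odd m : \sum_(j < m) j.*2.+1 = (m ^ 2)%N.
Proof.
elim: m => [|m IH]; first by rewrite big_ord0.
by rewrite big_ord_recr /= IH -mul2n; ring.
Qed.

Lemma big_shift_mod (f : nat -> C) c : (forall k, f (k %% q)%N = f k) ->
  \sum_(k < q) f (k + c)%N = \sum_(k < q) f k.
Proof.
move=> fq; rewrite [RHS](reindex_inj (addIr (inord (c %% q) : 'I_q))) /=.
apply: eq_bigr => k _; rewrite -[LHS]fq; congr f.
by rewrite /= inordK ?ltn_mod // modnDmr.
Qed.

Definition gauss_sum (w : C) := \sum_(k < q) w ^+ (k ^ 2).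

Lemma gauss_sum_prod :
  gauss_sum z = \prod_(j < n) (z ^+ j.*2.+1 - z ^- j.*2.+1).
Proof.
(* The shift n+1 is the inverse of 2 modulo q = 2n+1, so (k+n+1)^2 is congruent to n^2 + k(k+1). *)
rewrite /gauss_sum -(big_shift_mod (fun k => z ^+ (k ^ 2)) n.+1); last first.
  by move=> k; apply: prim_expr_eqmod; rewrite modnXm.
have -> : \sum_(k < q) z ^+ ((k + n.+1) ^ 2)
        = z ^+ (n ^ 2) * \sum_(k < q) z ^+ (k * k.+1).
  rewrite mulr_sumr; apply: eq_bigr => k _; rewrite -exprD; apply: prim_expr_eqmod.
  have -> : ((k + n.+1) ^ 2 = (k.+1) * q + (n ^ 2 + k * k.+1))%N.
    by move: (nat_of_ord k) => i; rewrite /q -mul2n; ring.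
  by rewrite modnMDl.
(* Writing n^2 as the sum of the first n odd numbers gives each factor 1 - z^-2(2j+1) its own
   z^(2j+1). *)
rewrite sum_expr_pronic -sum_odd expr_sum -big_split /=.
apply: eq_bigr => j _; rewrite mulrBr mulr1; congr (_ - _).
rewrite -exprMn -[RHS]exprVn; congr (_ ^+ _).
by rewrite expr2 invfM mulrA mulfV ?mul1r ?prim_root_neq0.
Qed.

(** Substituting x = u + y in the sum of z^(x^2 - y^2) leaves z^(u^2) times a geometric sum over y
    of ratio z^(2u). As q is odd, the ratio is 1 only for u = 0. *)
Lemma gauss_sumM : gauss_sum z * gauss_sum z^-1 = q%:R.
Proof.
have z0 := prim_root_neq0.
rewrite /gauss_sum mulr_sumr.
under eq_bigr => y _.
  rewrite -(big_shift_mod (fun k => z ^+ (k ^ 2)) y); last first.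
    by move=> k; apply: prim_expr_eqmod; rewrite modnXm.
  rewrite mulr_suml.
  under eq_bigr => u _.
    have -> : z ^+ ((u + y) ^ 2) * z^-1 ^+ (y ^ 2)
            = z ^+ (u ^ 2) * (z ^+ (u * 2)) ^+ y.
      have -> : ((u + y) ^ 2 = u ^ 2 + u * 2 * y + y ^ 2)%N.
        by move: (nat_of_ord u) (nat_of_ord y) => i k; ring.
      by rewrite exprD exprVn mulfK ?expf_neq0 // exprD exprM.
    over.
  over.
rewrite exchange_big /= (bigD1 ord0) //= [X in _ + X]big1 ?addr0.
  rewrite (eq_bigr (fun=> 1)) => [|y _]; first by rewrite big_const_ord iter_addr_0.
  by rewrite [_ ^+ (_ * 2)]expr0 expr1n mulr1.
move=> u u0; rewrite -mulr_sumr.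
have w1 : z ^+ (u * 2) - 1 != 0.
  rewrite subr_eq0 -(prim_order_dvd zq) Gauss_dvdl ?coprimen2 /= ?odd_double //.
  apply: contraNN u0 => qu; have [u_eq0|/dvdn_leq/(_ qu)] := posnP u.
    exact/eqP/val_inj.
  by rewrite leqNgt ltn_ord.
suff -> : \sum_(y < q) z ^+ (u * 2) ^+ y = 0 by rewrite mulr0.
apply: (mulfI w1); rewrite -subrX1 mulr0 -exprM mulnC exprM.
by rewrite (prim_expr_order zq) expr1n subrr.
Qed.

End GaussSum.

(** * Complex exponentials and roots of unity *)

Section RootsOfUnity.
Variable R : realType.

Lemma expiD (s t : R) : expi (s + t) = expi s * expi t.
Proof.
rewrite /expi cosD sinD; apply/eqP; rewrite eq_complex /= eqxx /=.
by rewrite addrC.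
Qed.

Lemma expi0 : expi (0 : R) = 1.
Proof. by rewrite /expi cos0 sin0. Qed.

Lemma expiMn (t : R) n : expi (t *+ n) = expi t ^+ n.
Proof. by elim: n => [|n IH]; rewrite ?expi0 // mulrS expiD IH exprS. Qed.

Lemma expiN (t : R) : expi (- t) = (expi t)^-1.
Proof.
have h : expi t * expi (- t) = 1 by rewrite -expiD subrr expi0.
have t0 : expi t != 0.
  by apply: contra_eq_neq h => ->; rewrite mul0r eq_sym oner_eq0.
by apply: (mulfI t0); rewrite h mulfV.
Qed.

Lemma expi_subV (t : R) : expi t - (expi t)^-1 = 'i%C * (2 * sin t)%:C%C.
Proof.
rewrite -expiN /expi cosN sinN; apply/eqP; rewrite eq_complex /=.
by apply/andP; split; apply/eqP; ring.
Qed.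

Definition zeta (q : nat) : R[i] := expi (2 * pi / q%:R).

Lemma expi_zeta q m : expi (2 * pi * m%:R / q%:R) = zeta q ^+ m.
Proof. by rewrite /zeta -expiMn -(mulr_natr (_ / _)) mulrAC. Qed.

(** The order divides the prime q. It is not 1, because 2 pi / q lies strictly between 0 and pi and
    so has positive sine. *)
Lemma zeta_prim q : prime q -> odd q -> q.-primitive_root (zeta q).
Proof.
move=> pq oq; have q0 : (q%:R : R) != 0 by rewrite pnatr_eq0 -lt0n prime_gt0.
have zq1 : zeta q ^+ q = 1.
  rewrite -expi_zeta mulfK // /expi mulr_natl.
  by rewrite cos2pi sin2pi.
have [m zm mq] := prim_order_exists (prime_gt0 pq) zq1.
move/primeP: (pq) => [_ /(_ m mq)] /orP[/eqP m1|/eqP mEq]; last by rewrite -{1}mEq.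
have := prim_expr_order zm; rewrite m1 expr1 => /eqP.
rewrite eq_complex /= => /andP[_ /eqP s0].
have q3 : (2 < q)%N by rewrite odd_prime_gt2.
have : 0 < sin (2 * pi / q%:R : R).
  have pi0 := pi_gt0 R; have q2 : (2 : R) < q%:R by rewrite ltr_nat.
  apply: sin_gt0_pi; apply/andP; split.
    by rewrite divr_gt0 ?mulr_gt0 // (lt_trans _ q2).
  by rewrite ltr_pdivrMr ?(lt_trans _ q2) // mulrC ltr_pM2l.
by rewrite s0 ltxx.
Qed.

End RootsOfUnity.

(** * Exact value of the Gauss sum, sign included *)

Section GaussSumSign.
Variables (R : realType) (n : nat).
Let q := n.*2.+1.

Lemma sum_leq_nat c m : (\sum_(j < m) (c <= j) = m - c)%N.
Proof.
elim: m => [|m IH]; first by rewrite big_ord0.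
by rewrite big_ord_recr /= IH; case: leqP; lia.
Qed.

Let f (j : nat) : R := 2 * sin (2 * pi * j.*2.+1%:R / q%:R).

(** The angle 2 pi (2j+1)/q is below 2 pi, and it exceeds pi exactly when q < 2(2j+1), that is when
    n <= 2j. *)
Lemma sin_sign (j : nat) : (j < n)%N -> 0 < (-1) ^+ (uphalf n <= j)%N * f j.
Proof.
move=> jn; have pi0 := pi_gt0 R; have q0 : (0 : R) < q%:R by rewrite ltr0n.
have sE : (uphalf n <= j)%N = (q < j.*2.+1.*2)%N.
  by rewrite /q; apply/idP/idP; lia.
rewrite /f mulrCA pmulr_rgt0 // sE; case: ltnP => h.
  (* For an angle t in (pi, 2 pi), - sin t = sin (2 pi - t) with 2 pi - t in (0, pi). *)
  rewrite expr1 mulN1r -sinN -[- _]addr0.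
  have -> : - (2 * pi * j.*2.+1%:R / q%:R) + 0
     = (2 * pi - 2 * pi * j.*2.+1%:R / q%:R) - pi *+ 2 :> R by ring.
  rewrite -[X in _ < X](sinD2pi) subrK.
  apply: sin_gt0_pi; apply/andP; split.
    rewrite subr_gt0 ltr_pdivrMr // ltr_pM2l ?mulr_gt0 // ltr_nat.
    by rewrite /q; lia.
  rewrite ltrBlDr -ltrBlDl.
  have -> : 2 * pi - pi = pi :> R by ring.
  rewrite ltr_pdivlMr // mulrAC mulrC ltr_pM2r // -natrM ltr_nat.
  by rewrite mul2n.
rewrite expr0 mul1r; apply: sin_gt0_pi; apply/andP; split.
  by rewrite divr_gt0 // !mulr_gt0 // ltr0n.
rewrite ltr_pdivrMr // mulrAC mulrC ltr_pM2l // -natrM ltr_nat mul2n.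
by rewrite /q in h *; lia.
Qed.

Hypothesis pq : prime q.

Lemma gauss_sum_sin :
  gauss_sum _ n (zeta R q) = 'i%C ^+ n * (\prod_(j < n) f j)%:C%C.
Proof.
rewrite gauss_sum_prod; last by apply: zeta_prim; rewrite //= odd_double.
rewrite rmorph_prod /= -[n in 'i%C ^+ n]card_ord -prodr_const -big_split /=.
by apply: eq_bigr => j _; rewrite -expi_zeta expi_subV.
Qed.

Lemma gauss_sum_sinV :
  gauss_sum _ n (zeta R q)^-1 = (-1) ^+ n * ('i%C ^+ n * (\prod_(j < n) f j)%:C%C).
Proof.
have zq : q.-primitive_root (zeta R q).
  by apply: zeta_prim; rewrite //= odd_double.
rewrite -gauss_sum_sin !gauss_sum_prod //; last exact: prim_rootV.
rewrite -[n in (-1) ^+ n]card_ord -prodr_const -big_split /=.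
by apply: eq_bigr => j _; rewrite -exprVn invrK exprVn mulN1r opprB.
Qed.

(** The square is q, because [gauss_sumM] reads (-1)^n i^(2n) S^2 = q. The sign comes from the n -
    [uphalf n] = [n./2] negative factors. *)
Lemma prod_sin : \prod_(j < n) f j = (-1) ^+ n./2 * Num.sqrt q%:R.
Proof.
have zq : q.-primitive_root (zeta R q).
  by apply: zeta_prim; rewrite //= odd_double.
set S := \prod_(j < n) f j.
have S2 : S ^+ 2 = q%:R.
  apply: (@complexI R); have := gauss_sumM _ _ _ zq.
  rewrite gauss_sum_sin gauss_sum_sinV -/S rmorph_nat => <-.
  rewrite rmorphXn /=; set s := S%:C%C.
  have i2 : ('i%C ^+ n * 'i%C ^+ n) * (-1) ^+ n = 1 :> R[i].
    by rewrite -!exprMn -expr2 sqr_i mulrNN mulr1 expr1n.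
  by rewrite -[LHS]mul1r -[X in X * _ = _]i2; ring.
have Sgt0 : 0 < (-1) ^+ n./2 * S.
  have -> : n./2 = (\sum_(j < n) (uphalf n <= j))%N by rewrite sum_leq_nat; lia.
  rewrite expr_sum -big_split /=; apply: prodr_gt0 => j _; exact: sin_sign.
have sq : Num.sqrt q%:R = (-1) ^+ n./2 * S.
  have -> : q%:R = ((-1) ^+ n./2 * S) ^+ 2 by rewrite exprMn sqrr_sign mul1r S2.
  by rewrite sqrtr_sqr gtr0_norm.
by rewrite sq mulrA -expr2 sqrr_sign mul1r.
Qed.

(** The unit i^n (-1)^(n./2) is 1 for even n and i for odd n, and q = 2n+1 is 1 modulo 4 exactly
    when n is even. *)
Lemma gauss_sum_zeta : gauss_sum _ n (zeta R q) = cq q.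
Proof.
rewrite gauss_sum_sin prod_sin /cq.
have := odd_double_half n; case: (boolP (odd n)) => _ /=; set m := n./2 => nm.
  have -> : (q %% 4 == 1)%N = false by rewrite /q -nm; lia.
  rewrite -nm add1n exprS -mul2n exprM sqr_i rmorphM rmorphXn /= rmorphN1.
  rewrite mulrA -[_ * _ * (-1) ^+ m]mulrA -expr2 sqrr_sign mulr1.
  by apply/eqP; rewrite eq_complex /=; apply/andP; split; apply/eqP; ring.
have -> : (q %% 4 == 1)%N by rewrite /q -nm; lia.
rewrite -nm add0n -mul2n exprM sqr_i rmorphM rmorphXn /= rmorphN1.
by rewrite mulrA -expr2 sqrr_sign mul1r.
Qed.

End GaussSumSign.

(** * Legendre symbols as characters of the prime field *)

Section PrimeField.
Variable q : nat.
Hypothesis pq : prime q.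

Lemma eqFp_mod (a b : nat) : (a%:R == b%:R :> 'F_q) = (a == b %[mod q]).
Proof. by rewrite -val_eqE /= !val_Fp_nat. Qed.

Lemma eqFp0 (a : nat) : (a%:R == 0 :> 'F_q) = (q %| a)%N.
Proof. by rewrite -[0]/(0%:R) eqFp_mod mod0n. Qed.

Lemma Fp_neq0_2 : odd q -> (2 : 'F_q) != 0.
Proof. by move=> oq; rewrite eqFp0 gtnNdvd // odd_prime_gt2. Qed.

Lemma legendreE a : legendre a q = quad_char _ (a%:R : 'F_q).
Proof.
rewrite /legendre /quad_char eqFp0; case: ifP => // _.
congr (if _ then _ else _); apply/existsP/existsP => -[x].
  by rewrite -eqFp_mod natrX => xa; exists (nat_of_ord x)%:R.
rewrite -[x]natr_Zp -natrX eqFp_mod => xa.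
have xq : (x < q)%N by rewrite -[X in (_ < X)%N](Fp_cast pq).
by exists (Ordinal xq).
Qed.

Lemma legendre_mod a b : (a = b %[mod q])%N -> legendre a q = legendre b q.
Proof. by move=> /eqP; rewrite -eqFp_mod => /eqP ab; rewrite !legendreE ab. Qed.

Lemma legendre_pm1 a : ~~ (q %| a)%N -> legendre a q = 1 \/ legendre a q = -1.
Proof.
rewrite /legendre => /negPf ->; case: ifP => _; by [left|right].
Qed.

Lemma sum_Fp (V : nmodType) (g : 'F_q -> V) :
  \sum_(r < q) g r%:R = \sum_x g x.
Proof.
rewrite -(big_mkord xpredT (fun r => g r%:R)) -{1}(Fp_cast pq) big_mkord.
by apply: eq_bigr => x _; rewrite natr_Zp.
Qed.

End PrimeField.

(** If q divides n, the symbol product is 0 and the indicator restores the value 2; otherwise the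
    product is 1 or -1. *)
Lemma xpqE (p q n : nat) (V : comNzRingType) : prime p -> prime q ->
  ~~ (p %| n)%N ->
  2 * (xpq p q n)%:R
    = 1 + (legendre n p * legendre n q)%:~R + (q %| n)%:R :> V.
Proof.
move=> pp pq pn; rewrite /xpq /jacobi2 ifF; last first.
  by apply: contraNF pn => h; apply: (dvdn_trans (dvdn_mulr q (dvdnn p))).
rewrite (negPf pn) /= andbT; case: ifP => qn.
  by rewrite /legendre qn mulr0 addr0 mulr1.
case: (legendre_pm1 _ n pn) => ->;
  case: (legendre_pm1 _ n (negbT qn)) => ->; rewrite /=; ring.
Qed.

Lemma xpq_mulp (p q r : nat) : prime p -> prime q -> p != q -> (r < q)%N ->
  xpq p q (r * p) = (r == 0%N).
Proof.
move=> pp pq neq rq; case: (posnP r) => [->|r0]; first by rewrite /xpq mod0n.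
have qr : ~~ (q %| r * p)%N.
  by rewrite Euclid_dvdM // gtnNdvd //= dvdn_prime2 // eq_sym.
rewrite /xpq ifF; last first.
  by apply: contraNF qr => h; apply: (dvdn_trans (dvdn_mull p (dvdnn q))).
by rewrite dvdn_mull // qr.
Qed.

(** * Additive characters of F_q and twisted Gauss sums *)

Section CharacterSums.
Variables (R : realType) (q : nat).
Hypotheses (pq : prime q) (oq : odd q).

Let zq : q.-primitive_root (zeta R q) := zeta_prim _ _ pq oq.
Let nz2 : (2 : 'F_q) != 0 := Fp_neq0_2 _ pq oq.

Definition Fp_char (x : 'F_q) : R[i] := zeta R q ^+ x.

Lemma Fp_char_nat m : Fp_char m%:R = zeta R q ^+ m.
Proof. by rewrite /Fp_char val_Fp_nat // (prim_expr_mod zq). Qed.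

Lemma Fp_charD x y : Fp_char (x + y) = Fp_char x * Fp_char y.
Proof.
by rewrite -[x]natr_Zp -[y]natr_Zp -natrD !Fp_char_nat exprD.
Qed.

Lemma Fp_char0 : Fp_char 0 = 1. Proof. exact: expr0. Qed.

Lemma Fp_charN x : Fp_char (- x) = (Fp_char x)^-1.
Proof.
have h : Fp_char x * Fp_char (- x) = 1 by rewrite -Fp_charD subrr Fp_char0.
have x0 : Fp_char x != 0.
  by apply: contra_eq_neq h => ->; rewrite mul0r eq_sym oner_eq0.
by apply: (mulfI x0); rewrite h mulfV.
Qed.

(** For a nonzero, scaling reduces to a = 1. Translation by 1 then multiplies the sum by
    [Fp_char 1], which is not 1. *)
Lemma sum_Fp_char a : \sum_x Fp_char (a * x) = if a == 0 then q%:R else 0.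
Proof.
case: eqVneq => [->|a0].
  under eq_bigr do rewrite mul0r Fp_char0.
  by rewrite sumr_const card_Fp.
rewrite -(reindex_inj (mulfI a0) (P := xpredT) (F := Fp_char)) /=.
have w1 : Fp_char 1 - 1 != 0.
  rewrite subr_eq0 -[1]/(1%:R : 'F_q) Fp_char_nat -(prim_order_dvd zq).
  by rewrite dvdn1 neq_ltn prime_gt1 ?orbT.
apply: (mulfI w1); rewrite mulr0 mulrBl mul1r mulr_sumr.
have -> : \sum_x Fp_char 1 * Fp_char x = \sum_x Fp_char (1 + x).
  by apply: eq_bigr => x _; rewrite Fp_charD.
by rewrite -(reindex_inj (addrI 1) (P := xpredT) (F := Fp_char)) subrr.
Qed.

(** For a nonzero, x -> x / a extracts [quad_char a]. The remaining sum is the Gauss sum, since the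
    1 in 1 + [quad_char t] contributes the zero sum of [Fp_char]. *)
Lemma sum_quad_char_Fp_char a :
  \sum_x (quad_char _ x)%:~R * Fp_char (a * x) = (quad_char _ a)%:~R * cq q.
Proof.
have [->|a0] := eqVneq a 0.
  under eq_bigr do rewrite mul0r Fp_char0 mulr1.
  by rewrite -rmorph_sum sum_quad_char // quad_char0 mul0r.
rewrite (reindex_inj (mulfI (invr_neq0 a0))) /=.
under eq_bigr do rewrite mulVKf // quad_charM // quad_charV // intrM -mulrA.
rewrite -mulr_sumr; congr (_ * _).
have := sum_quad_char_sq _ nz2 _ Fp_char.
under [RHS]eq_bigr do rewrite mulrDl mul1r.
rewrite big_split /=.
have -> : \sum_x Fp_char x = 0.
  have h := sum_Fp_char 1; rewrite oner_eq0 in h; apply: etrans h.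
  by apply: eq_bigr => x _; rewrite mul1r.
rewrite add0r => <-.
have := odd_double_half q; rewrite oq add1n => qE.
have := gauss_sum_zeta R q./2; rewrite qE => <- //.
rewrite /gauss_sum qE -(sum_Fp q pq _ (fun x => Fp_char (x ^+ 2))).
by apply: eq_bigr => k _; rewrite -natrX Fp_char_nat.
Qed.

End CharacterSums.

(** * The Zak transform of the Golomb sequence *)

Theorem theorem11 (R : realType) (p q : nat) (pinv : nat) :
  prime p -> odd p -> prime q -> q = (p + 2)%N ->
  ((p * pinv) %% q = 1)%N ->
  forall j k : nat, (j < q)%N -> (k < p)%N ->
  let alpha : R[i] := golomb_alpha p q in
  zak (@ypq R p q) p q j k =
    if (j == 0%N) && (k == 0%N) then 1 - alpha + alpha * q%:R
    else if j == 0%N then (1 - alpha) * (q.+1)%:R / 2 + alpha * q%:R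
    else if k == 0%N then 1 - alpha
    else (1 - alpha) / 2 *
         (1 + cq q * (legendre p q)%:~R * (legendre k p)%:~R * (legendre j q)%:~R) *
         expi (- (2 * pi * (pinv * k * j)%:R / q%:R)).
Proof.
move=> pp op pq qE ppinv j k jq kp alpha.
have oq : odd q by rewrite qE oddD op.
have neq : p != q by rewrite qE; lia.
have nz2 : (2 : 'F_q) != 0 := Fp_neq0_2 _ pq oq.
have P0 : (p%:R : 'F_q) != 0 by rewrite eqFp0 // dvdn_prime2 // eq_sym.
have pinvE : (pinv%:R : 'F_q) = p%:R^-1.
  apply: (mulfI P0); rewrite mulfV // -natrM; apply/eqP.
  by rewrite -[1]/(1%:R) eqFp_mod // ppinv modn_small ?prime_gt1.
pose J : 'F_q := j%:R; pose K : 'F_q := k%:R.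
have J0 : (J == 0) = (j == 0%N).
  rewrite eqFp0 //; case: (posnP j) => [->|j0]; first by rewrite dvdn0.
  by rewrite gtnNdvd.
have expE r : expi (2 * pi * (r * j)%:R / q%:R) = Fp_char R q (J * r%:R).
  by rewrite expi_zeta -Fp_char_nat // natrM mulrC.
(* The constant part alpha of the sequence contributes only at j = 0, by orthogonality. *)
have zakE : zak (@ypq R p q) p q j k
  = (1 - alpha) * (\sum_(r < q) (xpq p q (k + r * p))%:R * Fp_char R q (J * r%:R))
    + alpha * (if j == 0%N then q%:R else 0).
  rewrite -J0 -(sum_Fp_char R q pq oq) -(sum_Fp q pq _ (fun x => Fp_char R q (J * x))).
  rewrite /zak !mulr_sumr -big_split /=; apply: eq_bigr => r _.
  by rewrite expE /ypq -/alpha; ring.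
(* For k = 0 all samples are multiples of p, and x_pq vanishes there except at r = 0. *)
have [k0|k0] := posnP k.
  rewrite zakE.
  have -> : \sum_(r < q) (xpq p q (k + r * p))%:R * Fp_char R q (J * r%:R) = 1.
    have q0 := prime_gt0 pq; rewrite (bigD1 (Ordinal q0)) //= k0.
    rewrite xpq_mulp // eqxx mulr0 Fp_char0 mulr1 big1 ?addr0 // => r r0.
    by rewrite add0n xpq_mulp // (negPf r0 : (r == 0 :> nat) = false) mul0r.
  rewrite mulr1; case: (j == 0%N) => /=; by rewrite ?mulr0 ?addr0.
have pk r : ~~ (p %| k + r * p)%N by rewrite dvdn_addl ?dvdn_mull // gtnNdvd.
pose L : R[i] := (legendre k p)%:~R.
(* The phase at r = -k/p modulo q, the only r for which q divides k + r p. *)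
pose c := Fp_char R q (- (J * (K / p%:R))).
have cE : expi (- (2 * pi * (pinv * k * j)%:R / q%:R)) = c.
  rewrite expiN expE -Fp_charN //; congr (Fp_char _ _ (- (_ * _))).
  by rewrite natrM pinvE mulrC.
(* The three terms of [xpqE] give an orthogonality sum, a twisted Gauss sum and the single phase
   [c]. The symbol modulo p is constant, as k + r p is k modulo p. *)
have xpq_sum : 2 * (\sum_(r < q) (xpq p q (k + r * p))%:R * Fp_char R q (J * r%:R))
  = (if j == 0%N then q%:R else 0) + L * ((quad_char _ (J / p%:R))%:~R * cq q * c) + c.
  pose g x := (1 + L * (quad_char _ (K + x * p%:R))%:~R
               + (K + x * p%:R == 0)%:R) * Fp_char R q (J * x).
  transitivity (\sum_(x : 'F_q) g x).
    rewrite -sum_Fp // mulr_sumr; apply: eq_bigr => r _.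
    rewrite mulrA xpqE // /g -natrM -natrD eqFp0 // -legendreE // intrM.
    by rewrite (legendre_mod p pp (k + r * p) k) // addnC modnMDl.
  rewrite /g; under eq_bigr do rewrite !mulrDl mul1r.
  rewrite !big_split /= sum_Fp_char // J0; congr (_ + _ + _).
    under eq_bigr do rewrite -mulrA.
    rewrite -mulr_sumr; congr (_ * _).
    (* Together the two reindexings replace x by (x - K)/p: the character is then taken at x, the
       frequency becomes J/p, and [c] factors out. *)
    rewrite (reindex_inj (addIr (- (K / p%:R)))) /=.
    rewrite (reindex_inj (mulIf (invr_neq0 P0))) /=.
    rewrite -sum_quad_char_Fp_char // mulr_suml; apply: eq_bigr => x _.
    rewrite -[RHS]mulrA -Fp_charD //; congr (_ * _); last first.
      congr (Fp_char _ _ _); rewrite mulrBr; congr (_ - _).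
      by rewrite mulrA mulrAC.
    by rewrite mulrBl !mulfVK // addrC subrK.
  rewrite (bigD1 (- (K / p%:R))) //= mulNr mulfVK // subrr eqxx mul1r mulrN.
  rewrite big1 ?addr0 // => x xK; rewrite (_ : _ == _ = false) ?mul0r //.
  apply: contraNF xK; rewrite addrC addr_eq0 => /eqP h.
  by apply/eqP/(mulIf P0); rewrite h mulNr mulfVK.
have two : (2 : R[i]) != 0 by rewrite pnatr_eq0.
have -> : zak (@ypq R p q) p q j k
  = (1 - alpha) / 2
      * (2 * (\sum_(r < q) (xpq p q (k + r * p))%:R * Fp_char R q (J * r%:R)))
    + alpha * (if j == 0%N then q%:R else 0).
  by rewrite zakE mulrA mulfVK.
rewrite xpq_sum cE andbF; case: eqVneq => j0.
  have JE : J = 0 by rewrite /J j0.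
  rewrite /c JE !mul0r oppr0 Fp_char0 mulr0 addr0 natr1.
  by rewrite mulrAC.
rewrite quad_charM // quad_charV // -!legendreE // intrM -/L.
by field.
Qed.
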